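(* Let $\tau,\beta,\gamma>0$, $\mu\ge0$, $k=1/\gamma$, and let $V(t)$, $R(t)$ be $T$-periodic controls. Let $W(t)$ be the (positive) $T$-periodic solution of $$\dot W=\frac{\tau W}{k}(V-W).$$ Let $(\Lambda_F,\mathcal U_F)$ be the Floquet eigenelements of $$\frac{\partial}{\partial t}u(t,x)+V(t)\frac{\partial}{\partial x}\big(\tau x\,u(t,x)\big)+R(t)\mu\,u(t,x)=\mathcal F_\gamma u(t,x).$$ Then $$\exists\,C>0,\qquad \mathcal U_F(t,x)=C\,\mathcal U(W(t);x)\,e^{\int_0^t(\Lambda(W(s),R(s))-\Lambda_F)\,ds},$$ and $$\Lambda_F=\Lambda(\overline V,\overline R)=\overline{\Lambda(V,R)}.$$
   Context: $\kappa$ is a nonnegative measure on $[0,1]$ (written as a density) with $\int_0^1z\,\kappa(z)\,dz=1$, and $$\mathcal F_\gamma u(x)=\int_x^\infty \beta y^{\gamma-1}\kappa\Big(\frac xy\Big)u(y)\,dy-\beta x^\gamma u(x),\qquad x>0.$$ The equation is posed for $t\ge0,x>0$ with $u(t,0)=0$; $V(t)>0$, $R(t)\ge0$. For constants $V>0$, $R\ge0$, the Perron eigenelements $(\Lambda(V,R),\mathcal U(V;\cdot))$ are the solution (existence and uniqueness taken as known) of $$\Lambda\,\mathcal U(x)=-\frac{\partial}{\partial x}\big(V\tau x\,\mathcal U(x)\big)-R\mu\,\mathcal U(x)+\mathcal F_\gamma\mathcal U(x),\quad (x\,\mathcal U)(0)=0,\quad \mathcal U\ge0,\quad \int_0^\infty\mathcal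 U\,dx=1;$$ the eigenvector does not depend on $R$, $\mathcal U(V;x)=V^{-k}\,\mathcal U(1;V^{-k}x)$, and $\Lambda(V,R)=V\Lambda(1,0)-R\mu$. The Floquet eigenelements $(\Lambda_F,\mathcal U_F)$ are defined by: $\mathcal U_F(t,x)\,e^{\Lambda_Ft}$ is a (nonnegative) solution of the periodic equation, $t\mapsto\mathcal U_F(t,x)$ is $T$-periodic, and $\overline{\int_0^\infty\mathcal U_F(t,x)\,dx}=1$. For a $T$-periodic function $P$, $\overline P:=\frac1T\int_0^TP(t)\,dt$; in particular $\overline{\Lambda(V,R)}=\frac1T\int_0^T\Lambda(V(t),R(t))\,dt$.
   Formalization: The Floquet eigenelements are assumed to be unique (the claim fails for κ=2δ_{1/2}, constant V, R and resonant T), and solutions and eigenvectors are required to have a finite moment of order γ+1, with u(t,0)=0 read as vanishing of x u at 0. *)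

(* Defs.v *)
From HB Require Import structures.
From mathcomp Require Export all_boot all_order all_algebra.
From mathcomp Require Export all_classical all_reals all_analysis.
Set Implicit Arguments.
Unset Strict Implicit.
Unset Printing Implicit Defensive.
Import Order.TTheory GRing.Theory Num.Theory.
Import numFieldNormedType.Exports.
Local Open Scope classical_set_scope.
Local Open Scope ring_scope.

Section Time.
Context {R : realType}.
Implicit Types (T : R) (f g : R -> R).

(* Time ranges over [0, +oo[; values at negative times are irrelevant. *)
Definition periodic_on_nonneg T f := forall t, 0 <= t -> f (t + T) = f t.

Definition mean T f : R := T^-1 * \int[lebesgue_measure]_(t in `[0, T]) f t.

(* "f' = g" for a merely integrable g: f is locally absolutely continuous on
   [0, +oo[ and f' = g almost everywhere, written as the fundamental theorem
   of calculus.  For continuous g this is the classical f' = g. *)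
Definition ac_derivative f g := forall t, 0 <= t ->
  lebesgue_measure.-integrable `[0, t] (EFin \o g) /\
  f t = f 0 + \int[lebesgue_measure]_(s in `[0, t]) g s.

End Time.

Section GrowthFragmentation.
Context {R : realType}.
Variable kappa : {measure set (measurableTypeR R) -> \bar R}.
Variables tau beta gamma mu : R.
Implicit Types (v r Lam x t T : R) (U : R -> R) (V Rc : R -> R)
  (u UF : R -> R -> R).

(* Since kappa is a measure, the gain term
     int_x^oo beta y^(gamma-1) kappa(x/y) U(y) dy
   is read through z = x/y, dy = x/z^2 dz:
     int_]0,1] beta (x/z)^gamma U(x/z) z^-1 kappa(dz).
   A possible atom of kappa at 1 (y = x) is included; z = 0 corresponds to no
   finite y. *)
Definition gain_integrand U x z : R :=
  beta * (x / z) `^ gamma * U (x / z) / z.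

Definition frag U x : R :=
  \int[kappa]_(z in `]0, 1]) gain_integrand U x z - beta * x `^ gamma * U x.

Definition gain_integrable U x : Prop :=
  kappa.-integrable `]0%R, 1%R] (EFin \o gain_integrand U x).

Definition mass U : R := \int[lebesgue_measure]_(x in `]0, +oo[) U x.

(* Norm of L^1((1 + x^(gamma+1)) dx) on nonnegative functions.  Its finiteness
   says that the gain and loss parts of frag U have a finite first moment, so
   that fragmentation conserves int x U(x) dx.  Without it the eigenproblem is
   not well posed: for kappa = 2 dz, gamma = 1, every Lam > v tau (r = 0) has a
   positive integrable eigenfunction with a tail of order x^-3. *)
Definition weighted_mass U : \bar R :=
  (\int[lebesgue_measure]_(x in `]0%R, +oo[)
     ((1 + x `^ (gamma + 1)) * U x)%R%:E)%E.

(* The growth speed v tau x vanishes at x = 0, so the boundary condition bears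
   on the flux, i.e. on the trace of x U(x). *)
Definition zero_flux U : Prop := (fun x => x * U x) @ 0^'+ --> (0 : R).

Record perron_eigenelements v r Lam U : Prop := PerronEigenelements {
  perron_derivable : forall x, 0 < x -> derivable U x 1;
  perron_C1 : {in `]0, +oo[, continuous (derive1 U)};
  perron_ge0 : forall x, 0 < x -> 0 <= U x;
  perron_gain : forall x, 0 < x -> gain_integrable U x;
  perron_weighted : (weighted_mass U < +oo)%E;
  perron_equation : forall x, 0 < x ->
    Lam * U x = - derive1 (fun y => v * tau * y * U y) x - r * mu * U x + frag U x;
  perron_boundary : zero_flux U;
  perron_mass : mass U = 1
}.

Definition unique_perron_eigenelements v r Lam U : Prop :=
  perron_eigenelements v r Lam U /\
  forall Lam' U', perron_eigenelements v r Lam' U' ->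
    Lam' = Lam /\ forall x, 0 < x -> U' x = U x.

(* Nonnegative solutions on t >= 0, x > 0 of
     d_t u + V(t) d_x(tau x u) + R(t) mu u = F_gamma u,
   C^1 in x and absolutely continuous in t, as V and R are only assumed
   integrable. *)
Record nonneg_solution V Rc u : Prop := NonnegSolution {
  solution_continuous :
    {within [set p : R * R | 0 <= p.1 /\ 0 < p.2],
      continuous (fun p : R * R => u p.1 p.2)};
  solution_derivable : forall t x, 0 <= t -> 0 < x -> derivable (u t) x 1;
  solution_C1 :
    {within [set p : R * R | 0 <= p.1 /\ 0 < p.2],
      continuous (fun p : R * R => derive1 (u p.1) p.2)};
  solution_ge0 : forall t x, 0 <= t -> 0 < x -> 0 <= u t x;
  solution_gain : forall t x, 0 <= t -> 0 < x -> gain_integrable (u t) x;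
  solution_weighted : forall t, 0 <= t ->
    (\int[lebesgue_measure]_(s in `[0%R, t]) weighted_mass (u s) < +oo)%E;
  solution_equation : forall x, 0 < x ->
    ac_derivative (u ^~ x) (fun t =>
      - (V t * derive1 (fun y => tau * y * u t y) x)
      - Rc t * mu * u t x + frag (u t) x);
  solution_boundary : forall t, 0 <= t -> zero_flux (u t)
}.

Record floquet_eigenelements T V Rc LamF UF : Prop := FloquetEigenelements {
  floquet_solution : nonneg_solution V Rc (fun t x => UF t x * expR (LamF * t));
  floquet_periodic : forall x, 0 < x -> periodic_on_nonneg T (UF ^~ x);
  floquet_mass : mean T (fun t => mass (UF t)) = 1
}.

(* Uniqueness is not automatic: for kappa = 2 delta_(1/2) and V, R constant,
   periods T that are multiples of ln 2 / (tau V) admit several periodic UF. *)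
Definition unique_floquet_eigenelements T V Rc LamF UF : Prop :=
  floquet_eigenelements T V Rc LamF UF /\
  forall LamF' UF', floquet_eigenelements T V Rc LamF' UF' ->
    LamF' = LamF /\ forall t x, 0 <= t -> 0 < x -> UF' t x = UF t x.

End GrowthFragmentation.

(* Main.v *)
Require Import Defs.
From mathcomp Require Import measurable_realfun ring lra.
Set Implicit Arguments.
Unset Strict Implicit.
Import Order.TTheory GRing.Theory Num.Theory.
Import numFieldNormedType.Exports.
Local Open Scope classical_set_scope.
Local Open Scope ring_scope.

(** Dilating the size variable multiplies the fragmentation operator by a
    constant, which amounts to changing the growth speed: if U1 is the Perron
    eigenvector for v = 1 and r = 0, with eigenvalue L1, then
      d U1(d x),   d = v^(-k),
    is the one for the speed v and the death term r, with eigenvalue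
    v L1 - r mu, because the fragmentation operator is homogeneous of degree
    gamma = 1/k ([frag_rescale], [perron_rescale]).  Uniqueness identifies this
    pair with the given U v and Lam v r.

    With time-dependent V, let the dilation follow the logistic equation: for
    d(t) = W(t)^(-k) one has d'/d = tau (W - V).  Writing the Perron equation
    at speed W, the function u(t, x) = U(W(t); x) has a dilation term
    d'/d d_x(x u) which is exactly the transport defect (W - V) tau d_x(x u), so
    that
      u(t, x) = U(W(t); x) exp(int_0^t Lam(W, R))
    solves the evolution equation ([self_similar_solution]).  The amplitude
    grows over one period by exp(T Lam(mean W, mean R)); dividing by the
    corresponding exponential and by the mean mass gives Floquet eigenelements,
    and uniqueness says that they are the given ones.  Finally
    mean W = mean V since ln W is periodic with derivative proportional to
    V - W, and Lam is linear in (v, r).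

    V and R being merely integrable, these computations take place among
    absolutely continuous functions of time, encoded as primitives of integrable
    functions.  What is needed is the chain rule for a C^1 outer function
    ([ac_derivative_comp]); the product rule follows by polarisation
    ([ac_derivativeM]).  Masses and periods are handled by the affine change of
    variables for the Lebesgue integral ([ge0_integral_affine]). *)

(** * Affine changes of variables *)

Section Affine.
Context {R : realType}.
Notation leb := (@lebesgue_measure R).
Variables (a b : R).
Hypothesis a_gt0 : 0 < a.

Let aff : measurableTypeR R -> measurableTypeR R := fun x => a * x + b.

Let measurable_aff : measurable_fun setT aff.
Proof.
by apply: measurable_funD => //; exact: measurable_funM.
Qed.

(** The left-hand side is a measure in A, and it agrees with the Lebesgue measure
    on half-open intervals. *)
Lemma lebesgue_measure_affine (A : set (measurableTypeR R)) : measurable A ->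
  (a%:E * leb [set x | A (a * x + b)%R] = leb A)%E.
Proof.
move=> mA.
suff : leb A = mscale (NngNum (ltW a_gt0)) (pushforward leb aff) A by move=> ->.
move=> maff; apply: lebesgue_measure_unique => //= _ [[c d]] _ <-.
transitivity (a%:E * leb `]((c - b) / a)%R, ((d - b) / a)%R])%E; last first.
  congr (_ * _)%E; congr (leb _); apply/seteqP.
  split=> x; rewrite /= !in_itv/= /aff;
  by rewrite ltr_pdivrMr// ler_pdivlMr// (mulrC x) ltrBlDr lerBrDr.
rewrite !lebesgue_measure_itv/= !lte_fin ltr_pM2r ?invr_gt0// ltrD2r.
case: ifPn => _; last by rewrite mule0.
rewrite -!EFinD -EFinM -mulrBl opprB addrA subrK mulrC -mulrA mulVf ?mulr1//.
by rewrite gt_eqF.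
Qed.

Lemma measurable_fun_affine d (Y : measurableType d) (D : set (measurableTypeR R))
    (f : measurableTypeR R -> Y) : measurable D -> measurable_fun D f ->
  measurable_fun [set x | D (a * x + b)] (fun x => f (a * x + b)).
Proof.
move=> mD mf; apply: (measurable_comp mD _ mf); last exact: measurable_funTS.
by move=> _ [x Dx <-].
Qed.

Lemma ge0_integral_affine (D : set (measurableTypeR R))
    (f : measurableTypeR R -> \bar R) :
  measurable D -> measurable_fun D f -> (forall y, D y -> 0 <= f y)%E ->
  (\int[leb]_(y in D) f y =
   a%:E * \int[leb]_(x in [set x | D (a * x + b)%R]) f (a * x + b)%R)%E.
Proof.
move=> mD mf f0.
have := @ge0_integral_pushforward _ _ _ _ _ aff measurable_aff leb D f mD mf.
rewrite /= => <-; last by move=> y; rewrite inE; exact: f0.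
rewrite -(@ge0_integral_mscale _ _ _ (pushforward leb aff) D mD
  (NngNum (ltW a_gt0)) f mf f0).
by apply: eq_measure_integral => A mA AD; have := lebesgue_measure_affine mA.
Qed.

End Affine.

Section Shift.
Context {R : realType}.
Notation leb := (@lebesgue_measure R).
Implicit Types (D : set (measurableTypeR R)) (f : R -> R).

Lemma ge0_integral_shift b D (f : measurableTypeR R -> \bar R) :
  measurable D -> measurable_fun D f -> (forall y, D y -> 0 <= f y)%E ->
  (\int[leb]_(y in D) f y =
   \int[leb]_(x in [set x | D (x + b)%R]) f (x + b)%R)%E.
Proof.
move=> mD mf f0; rewrite (ge0_integral_affine b ltr01)// mul1e.
have -> : [set x | D (1 * x + b)] = [set x | D (x + b)].
  by apply/seteqP; split=> x /=; rewrite mul1r.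
by apply: eq_integral => x _; rewrite mul1r.
Qed.

Lemma measurable_fun_shift d (Y : measurableType d) b D
    (f : measurableTypeR R -> Y) : measurable D -> measurable_fun D f ->
  measurable_fun [set x | D (x + b)] (fun x => f (x + b)).
Proof.
move=> mD /(@measurable_fun_affine R 1 b _ _ _ _ mD).
have -> : [set x | D (1 * x + b)] = [set x | D (x + b)].
  by apply/seteqP; split=> x /=; rewrite mul1r.
by congr measurable_fun; apply/funext => x; rewrite mul1r.
Qed.

Lemma integrable_shift b D f : measurable D ->
  leb.-integrable D (EFin \o f) ->
  leb.-integrable [set x | D (x + b)] (EFin \o (fun x => f (x + b))).
Proof.
move=> mD /integrableP[mf foo]; apply/integrableP; split.
  exact: (@measurable_fun_shift _ _ b _ _ mD mf).
rewrite -(@ge0_integral_shift b D (fun y => `|(f y)%:E|)%E)//.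
exact: measurableT_comp.
Qed.

Lemma Rintegral_shift b D f : measurable D ->
  leb.-integrable D (EFin \o f) ->
  \int[leb]_(y in D) f y = \int[leb]_(x in [set x | D (x + b)]) f (x + b).
Proof.
move=> mD intf; have mf := measurable_int _ intf.
rewrite /Rintegral; congr fine.
rewrite [LHS]integralE [RHS]integralE; congr (_ - _)%E.
  rewrite (@ge0_integral_shift b)//; last exact: measurable_funepos.
  by apply: eq_integral => x _; rewrite !funeposE.
rewrite (@ge0_integral_shift b)//; last exact: measurable_funeneg.
by apply: eq_integral => x _; rewrite !funenegE.
Qed.

End Shift.

Section IntegrableUnion.
Context d (T : measurableType d) (R : realType) (nu : {measure set T -> \bar R}).

Lemma integrable_setU (A B : set T) (f : T -> \bar R) :
  measurable A -> measurable B ->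
  nu.-integrable A f -> nu.-integrable B f -> nu.-integrable (A `|` B) f.
Proof.
move=> mA mB /integrableP[mfA fA] /integrableP[mfB fB]; apply/integrableP.
have mf : measurable_fun (A `|` B) f by exact/measurable_funU.
have mnf : measurable_fun (A `|` B) (abse \o f) by exact: measurableT_comp.
split=> //; rewrite -(setDUK (@subsetUl _ A B)).
have sB : (A `|` B) `\` A `<=` B by move=> x [[]].
have mD : measurable ((A `|` B) `\` A).
  by apply: measurableD => //; exact: measurableU.
rewrite ge0_integral_setU ?setDUK//; last by rewrite disj_set2E setDIK.
apply: lte_add_pinfty => //; apply: le_lt_trans fB.
by apply: ge0_subset_integral => //; exact: measurableT_comp.
Qed.

End IntegrableUnion.

(** * Primitives of integrable functions and the chain rule *)

Section Primitive.
Context {R : realType}.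
Notation leb := (@lebesgue_measure R).
Implicit Types (f g h F G : R -> R).

Definition locally_integrable_on_nonneg g :=
  forall t : R, 0 <= t -> leb.-integrable `[0, t] (EFin \o g).

Definition primitive g (t : R) := \int[leb]_(s in `[0, t]) g s.

Lemma primitive0 g : primitive g 0 = 0.
Proof. by rewrite /primitive set_itv1 Rintegral_set1. Qed.

Lemma primitive_lt0 g t : t < 0 -> primitive g t = 0.
Proof.
by move=> t0; rewrite /primitive set_itv_ge ?Rintegral_set0// -leNgt bnd_simp.
Qed.

Lemma primitiveB g s t : locally_integrable_on_nonneg g -> 0 <= s -> s <= t ->
  primitive g t - primitive g s = \int[leb]_(r in `]s, t]) g r.
Proof.
move=> ig s0 st; rewrite /primitive Rintegral_itvB ?bnd_simp//.
exact/ig/(le_trans s0).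
Qed.

(** Continuity holds on the whole line, and not only on [0, +oo[: the integral
    over an empty interval vanishes, so the primitive is constant at negative
    times.  This spares one-sided limits later on. *)
Lemma primitive_continuous g :
  locally_integrable_on_nonneg g -> continuous (primitive g).
Proof.
move=> ig t.
pose a := - (`|t| + 1); pose b := `|t| + 1.
have b0 : 0 < b by rewrite ltr_wpDl.
have at_ : a < t by rewrite /a ltrNl (le_lt_trans (ler_norm _))// normrN ltrDl.
have tb : t < b by rewrite /b (le_lt_trans (ler_norm _))// ltrDl.
have a0 : a < 0 by rewrite oppr_lt0.
have intE x : a <= x ->
    parameterized_integral leb a x (g \_ `[0, +oo[) = primitive g x.
  move=> ax; rewrite /parameterized_integral -Rintegral_mkcondr /primitive.
  congr (Rintegral _ _ _); apply/seteqP; split => y /=; rewrite !in_itv/= ?andbT.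
    by move=> [/andP[_ ->] ->].
  by move=> /andP[y0 ->]; rewrite y0 (le_trans (ltW a0)).
have ig' : leb.-integrable `[a, b] (EFin \o (g \_ `[0, +oo[)).
  rewrite -restrict_EFin; apply/integrable_restrict => //=.
  apply: integrableS (ig _ (ltW b0)) => //=.
    exact: measurableI.
  by move=> y /=; rewrite !in_itv/= => -[/andP[_ ->]]; rewrite andbT => ->.
have := parameterized_integral_continuous (ltW (lt_trans a0 b0)) ig'.
rewrite continuous_within_itvP ?(lt_trans a0)// => -[+ _ _] => /(_ t).
rewrite in_itv/= at_ tb => /(_ isT) ct.
rewrite /continuous_at -intE ?ltW//; apply: cvg_trans ct.
apply: near_eq_cvg; near=> x; apply: intE; near: x.
exact: lt_le_nbhsr.
Unshelve. all: by end_near. Qed.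

Lemma locally_integrable_on_nonneg_norm g : locally_integrable_on_nonneg g ->
  locally_integrable_on_nonneg (Num.norm \o g).
Proof. by move=> ig t t0; apply: integrable_norm; exact: ig. Qed.

Lemma Rintegral_bounded_mul g h e s t :
  locally_integrable_on_nonneg g -> locally_integrable_on_nonneg (h \* g) ->
  0 <= s -> s <= t -> (forall r, s < r -> r <= t -> `|h r| <= e) ->
  `|\int[leb]_(r in `]s, t]) (h r * g r)| <=
    e * (primitive (Num.norm \o g) t - primitive (Num.norm \o g) s).
Proof.
move=> ig ihg s0 st he.
have t0 := le_trans s0 st.
have sub (k : R -> R) : locally_integrable_on_nonneg k ->
    leb.-integrable `]s, t] (EFin \o k).
  move=> /(_ t t0); apply: integrableS => //= x /=.
  by rewrite !in_itv/= => /andP[sx ->]; rewrite (le_trans s0 (ltW sx)).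
have ig' := sub _ (locally_integrable_on_nonneg_norm ig).
rewrite primitiveB//; last exact: locally_integrable_on_nonneg_norm.
rewrite -RintegralZl//.
apply: le_trans (le_normr_Rintegral _ (sub _ ihg)) _ => //.
apply: le_Rintegral => //.
- exact: sub _ (locally_integrable_on_nonneg_norm ihg).
- rewrite (_ : EFin \o _ = (fun x => e%:E * (EFin \o (Num.norm \o g)) x)%E).
    exact: integrableZl.
  by apply/funext => x.
- move=> x /=; rewrite in_itv/= => /andP[sx xt].
  by rewrite normrM ler_wpM2r// he.
Qed.

Lemma primitive_norm_nd g s t : locally_integrable_on_nonneg g -> 0 <= s -> s <= t ->
  `|primitive g t - primitive g s| <=
    primitive (Num.norm \o g) t - primitive (Num.norm \o g) s.
Proof.
move=> ig s0 st; rewrite primitiveB// -[leRHS]mul1r.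
have := @Rintegral_bounded_mul g (cst 1) 1 s t ig _ s0 st _.
under eq_Rintegral do rewrite mul1r.
apply => [|r _ _]; last by rewrite normr1.
by rewrite (_ : cst 1 \* g = g)//; apply/funext => x /=; rewrite mul1r.
Qed.

Lemma locally_integrable_on_nonneg_continuousM h g : continuous h ->
  locally_integrable_on_nonneg g ->
  locally_integrable_on_nonneg (fun t => h t * g t).
Proof.
move=> ch ig t t0.
have := @integrableMr _ _ _ leb `[0, t] _ h (EFin \o g).
apply => //; last exact: ig.
  by apply: measurable_funTS; apply: continuous_measurable_fun.
have /compact_bounded[M [Mr Mh]] : compact (h @` `[0, t]).
  apply: continuous_compact; first exact: continuous_subspaceT.
  exact: segment_compact.
by exists M; split => // x Mx y /= yt; apply: Mh => //; exists y.
Qed.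

(** Real induction: the set of the t with |E t - E a| <= e (G t - G a) contains
    its supremum and can be continued beyond it.  Letting e tend to 0, increments
    of E that are locally negligible with respect to those of G add up to
    nothing. *)
Lemma small_increments_const (E G : R -> R) (a b : R) : a <= b ->
  (forall e, 0 < e -> forall s, a <= s <= b -> exists2 d, 0 < d &
    forall u v, a <= u -> u <= v -> v <= b -> `|u - s| < d -> `|v - s| < d ->
      `|E v - E u| <= e * (G v - G u)) ->
  E b = E a.
Proof.
move=> ab loc.
have bnd e : 0 < e -> `|E b - E a| <= e * (G b - G a).
  move=> e0; pose S := [set t | a <= t <= b /\ `|E t - E a| <= e * (G t - G a)].
  have Sa : S a by rewrite /S/= lexx ab !subrr mulr0 normr0.
  have ubS : ubound S b by move=> x [/andP[]].
  have hsS : has_sup S by split; [exists a | exists b].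
  have ac : a <= sup S by exact: (sup_upper_bound hsS).
  have cb : sup S <= b by apply: ge_sup => //; exists a.
  have /(loc _ e0)[d d0 dP] : a <= sup S <= b by rewrite ac.
  have [t St ct] := sup_adherent d0 hsS.
  have tc : t <= sup S by exact: (sup_upper_bound hsS).
  have /andP[at_ tb] := St.1.
  pose t' := Num.min b (sup S + d / 2).
  have ct' : sup S <= t' by rewrite le_min cb lerDl divr_ge0// ltW.
  have tt' : t <= t' by exact: le_trans ct'.
  have t'b : t' <= b by rewrite ge_min lexx.
  have t'd : t' <= sup S + d / 2 by rewrite ge_min lexx orbT.
  have St' : S t'.
    split; first by rewrite t'b (le_trans at_).
    have -> : E t' - E a = (E t' - E t) + (E t - E a) by rewrite addrA subrK.
    have -> : G t' - G a = (G t' - G t) + (G t - G a) by rewrite addrA subrK.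
    rewrite mulrDr (le_trans (ler_normD _ _))// lerD ?(St.2)//.
    apply: dP => //; rewrite ltr_norml; lra.
  have t'c : t' <= sup S by exact: (sup_upper_bound hsS).
  have t'E : t' = b.
    by move: t'c; rewrite /t' minEle; case: ifPn => // _; lra.
  by rewrite -t'E; exact: St'.2.
apply/eqP; rewrite -subr_eq0 -normr_le0; apply/ler_addgt0Pl => e e0.
rewrite addr0.
have G0 : 0 <= `|G b - G a| by [].
have := bnd (e / (`|G b - G a| + 1)) _.
rewrite divr_gt0 ?ltr_wpDl// => /(_ isT) /le_trans; apply.
rewrite -mulrA ler_piMr ?(ltW e0)// mulrC ler_pdivrMr ?ltr_wpDl// mul1r.
by rewrite (le_trans (ler_norm _))// lerDl.
Qed.

Lemma mean_value_bound (phi dphi : R -> R) (D e x y : R) :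
  (forall z, Num.min x y <= z <= Num.max x y -> is_derive z 1 phi (dphi z)) ->
  (forall z, Num.min x y <= z <= Num.max x y -> `|dphi z - D| <= e) ->
  `|phi y - phi x - D * (y - x)| <= e * `|y - x|.
Proof.
wlog xy : x y / x <= y => [wl|].
  have [|yx dp de] := boolP (x <= y); first exact: wl.
  have {}yx : y <= x by rewrite ltW// ltNge.
  rewrite (_ : _ - _ - _ = - (phi x - phi y - D * (x - y))); last by ring.
  rewrite normrN (distrC y); apply: wl => // z; rewrite minC maxC.
    exact: dp.
  exact: de.
rewrite min_l// max_r// => dp de.
have [z||z zxy ->] := @MVT_segment R phi dphi x y xy.
- by rewrite in_itv/= => /andP[xz zy]; apply: dp; rewrite !ltW.
- apply: derivable_within_continuous => z; rewrite in_itv/= => /dp h.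
  exact: ex_derive.
by rewrite -mulrBl normrM ler_wpM2r// de//; move: zxy; rewrite in_itv.
Qed.

(** The chain rule follows from [small_increments_const], with
    E = phi(f) - int dphi(f) g and G = int |g|.  Near a time s, the mean value
    theorem and the integral both compare the increments of phi(f) and of
    int dphi(f) g with dphi(f s) times the increment of f, up to an arbitrarily
    small multiple of int |g|, because dphi is continuous at f s. *)
Lemma ac_derivative_comp (phi dphi : R -> R) f g :
  ac_derivative f g ->
  (forall t : R, 0 <= t ->
    \forall y \near (f t : R), is_derive (y : R) 1 phi (dphi y)) ->
  (forall t : R, 0 <= t -> {for f t, continuous dphi}) ->
  ac_derivative (phi \o f) (fun t => dphi (f t) * g t).
Proof.
move=> acf dphiP cdphi.
have ig : locally_integrable_on_nonneg g by move=> t /acf[].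
(* f is only controlled at nonnegative times; F is a continuous extension. *)
pose F t := f 0 + primitive g t.
have fE t : 0 <= t -> f t = F t by move=> /acf[].
have cF : continuous F.
  move=> t; apply: continuousD; first exact: cst_continuous.
  exact: primitive_continuous.
have F_range t : exists2 s, 0 <= s & F t = f s.
  have [t0|t0] := leP 0 t; first by exists t; rewrite ?fE.
  by exists 0 => //; rewrite /F primitive_lt0// addr0.
have cH : continuous (dphi \o F).
  move=> t; apply: continuous_comp; first exact: cF.
  by have [s s0 ->] := F_range t; exact: cdphi.
have ihg : locally_integrable_on_nonneg (fun t => (dphi \o F) t * g t).
  exact: locally_integrable_on_nonneg_continuousM.
have iE t : 0 <= t ->
    leb.-integrable `[0, t] (EFin \o (fun s => dphi (f s) * g s)) /\
    \int[leb]_(s in `[0, t]) (dphi (f s) * g s) =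
      primitive (fun t => (dphi \o F) t * g t) t.
  move=> t0; split.
    apply: eq_integrable (ihg t t0) => //= s.
    by rewrite inE/= in_itv/= => /andP[s0 _]; rewrite fE.
  apply: eq_Rintegral => s; rewrite inE/= in_itv/= => /andP[s0 _].
  by rewrite /= fE.
move=> t t0; have [i1 ->] := iE t t0; split=> //.
set K := primitive _.
suff : phi (F t) - K t = phi (F 0) - K 0.
  by rewrite /= !fE// /K primitive0 subr0 => <-; rewrite subrK.
apply: (@small_increments_const (fun t => phi (F t) - K t)
  (primitive (Num.norm \o g)) 0 t t0).
move=> e e0 s /andP[s0 st].
have e20 : 0 < e / 2 by rewrite divr_gt0.
have : \forall y \near (F s : R),
    is_derive (y : R) 1 phi (dphi y) /\ `|dphi y - dphi (F s)| <= e / 2.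
  rewrite -fE//; apply: filterI; first exact: dphiP.
  have /cvgrPdist_le/(_ _ e20) := cdphi _ s0.
  by apply: filterS => y; rewrite distrC.
move=> /nbhs_ballP[rho /= rho0 rhoP].
have /cvgrPdist_lt/(_ _ rho0)/nbhs_ballP[d /= d0 dP] := cF s.
exists d => // u v u0 uv vt us vs.
have near_s r : u <= r -> r <= v -> `|F s - F r| < rho.
  move=> ur rv; apply: dP; rewrite /ball/= distrC.
  by move: us vs; rewrite !ltr_norml; lra.
have Fbetween z :
    Num.min (F u) (F v) <= z <= Num.max (F u) (F v) -> ball (F s) rho z.
  have := near_s _ (lexx u) uv; have := near_s _ uv (lexx v).
  rewrite /ball/= !ltr_norml minEle maxEle.
  by case: (leP (F u) (F v)) => _ /andP[? ?] /andP[? ?] /andP[? ?]; lra.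
have -> : phi (F v) - K v - (phi (F u) - K u) =
    (phi (F v) - phi (F u) - dphi (F s) * (F v - F u)) -
    (\int[leb]_(r in `]u, v]) ((dphi (F r) - dphi (F s)) * g r)).
  have -> : \int[leb]_(r in `]u, v]) ((dphi (F r) - dphi (F s)) * g r) =
      (K v - K u) - dphi (F s) * (F v - F u).
    have sub (k : R -> R) : locally_integrable_on_nonneg k ->
        leb.-integrable `]u, v] (EFin \o k).
      move=> /(_ v (le_trans u0 uv)); apply: integrableS => //= x /=.
      by rewrite !in_itv/= => /andP[sx ->]; rewrite (le_trans u0 (ltW sx)).
    under eq_Rintegral do rewrite mulrBl.
    rewrite RintegralB//; last 2 first.
    - exact: sub _ ihg.
    - apply: sub.
      apply: (@locally_integrable_on_nonneg_continuousM (cst (dphi (F s)))) ig => //.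
      exact: cst_continuous.
    rewrite -(primitiveB ihg u0 uv) RintegralZl//; last exact: sub.
    have -> : F v - F u = primitive g v - primitive g u by rewrite /F; ring.
    by rewrite -(primitiveB ig u0 uv).
  by ring.
rewrite (le_trans (ler_normB _ _))// (_ : e = e / 2 + e / 2); last by field.
rewrite mulrDl lerD//.
  apply: (@le_trans _ _ (e / 2 * `|F v - F u|)).
    by apply: (@mean_value_bound phi dphi) => z /Fbetween/rhoP[].
  rewrite ler_wpM2l ?(ltW e20)//.
  have -> : F v - F u = primitive g v - primitive g u by rewrite /F; ring.
  exact: primitive_norm_nd.
apply: (@Rintegral_bounded_mul g (fun r => dphi (F r) - dphi (F s))) => //.
  apply: locally_integrable_on_nonneg_continuousM => // x.
  by apply: continuousB; [exact: cH|exact: cst_continuous].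
move=> r ur rv.
by have [|] := rhoP (F r) _ => //; apply: near_s => //; exact: ltW.
Qed.

End Primitive.

Section AcAlgebra.
Context {R : realType}.
Notation leb := (@lebesgue_measure R).
Implicit Types (f g h F G : R -> R).

Lemma eq_primitive g1 g2 t : (forall s : R, 0 <= s -> g1 s = g2 s) ->
  primitive g1 t = primitive g2 t.
Proof.
move=> g12; apply: eq_Rintegral => s; rewrite inE/= in_itv/= => /andP[s0 _].
exact: g12.
Qed.

Lemma eq_locally_integrable g1 g2 : (forall s : R, 0 <= s -> g1 s = g2 s) ->
  locally_integrable_on_nonneg g1 -> locally_integrable_on_nonneg g2.
Proof.
move=> g12 i1 t t0; apply: eq_integrable (i1 t t0) => //= s.
by rewrite inE/= in_itv/= => /andP[s0 _]; rewrite g12.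
Qed.

Lemma ac_derivativeP f g : ac_derivative f g <->
  locally_integrable_on_nonneg g /\ forall t : R, 0 <= t -> f t = f 0 + primitive g t.
Proof.
split=> [fg|[ig fE] t t0]; last by split; [exact: ig|exact: fE].
by split=> t /fg[].
Qed.

Lemma eq_ac_derivative f1 f2 g1 g2 :
  (forall t : R, 0 <= t -> f1 t = f2 t) -> (forall t : R, 0 <= t -> g1 t = g2 t) ->
  ac_derivative f1 g1 -> ac_derivative f2 g2.
Proof.
move=> f12 g12 /ac_derivativeP[ig fE]; apply/ac_derivativeP; split.
  exact: eq_locally_integrable ig.
by move=> t t0; rewrite -!f12// fE// (eq_primitive t g12).
Qed.

Lemma locally_integrable_on_nonnegD g1 g2 : locally_integrable_on_nonneg g1 ->
  locally_integrable_on_nonneg g2 -> locally_integrable_on_nonneg (g1 \+ g2).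
Proof.
move=> i1 i2 t t0.
have -> : EFin \o (g1 \+ g2) = ((EFin \o g1) \+ (EFin \o g2))%E by exact/funext.
by apply: integrableD => //; [exact: i1|exact: i2].
Qed.

Lemma locally_integrable_on_nonnegZ c g : locally_integrable_on_nonneg g ->
  locally_integrable_on_nonneg (fun t => c * g t).
Proof. exact/locally_integrable_on_nonneg_continuousM/cst_continuous. Qed.

Lemma locally_integrable_on_nonneg_continuous g :
  continuous g -> locally_integrable_on_nonneg g.
Proof.
move=> cg t t0; apply: continuous_compact_integrable; first exact: segment_compact.
exact: continuous_subspaceT.
Qed.

Lemma primitiveD g1 g2 t : locally_integrable_on_nonneg g1 ->
  locally_integrable_on_nonneg g2 -> 0 <= t ->
  primitive (g1 \+ g2) t = primitive g1 t + primitive g2 t.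
Proof.
by move=> i1 i2 t0; rewrite /primitive RintegralD//; [exact: i1|exact: i2].
Qed.

Lemma primitiveZ c g t : locally_integrable_on_nonneg g -> 0 <= t ->
  primitive (fun s => c * g s) t = c * primitive g t.
Proof. by move=> ig t0; rewrite /primitive RintegralZl//; exact: ig. Qed.

Lemma primitive_cst (c t : R) : 0 <= t -> primitive (cst c) t = c * t.
Proof.
move=> t0; rewrite /primitive Rintegral_cst//= lebesgue_measure_itv/= lte_fin.
by case: ltgtP t0 => //= [_ _|<- _]; rewrite ?oppr0 ?addr0// mulr0.
Qed.

Lemma ac_derivative_primitive c g : locally_integrable_on_nonneg g ->
  ac_derivative (fun t => c + primitive g t) g.
Proof.
by move=> ig; apply/ac_derivativeP; split=> // t _; rewrite primitive0 addr0.
Qed.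

Lemma ac_derivativeD f1 f2 g1 g2 : ac_derivative f1 g1 -> ac_derivative f2 g2 ->
  ac_derivative (f1 \+ f2) (g1 \+ g2).
Proof.
move=> /ac_derivativeP[i1 f1E] /ac_derivativeP[i2 f2E]; apply/ac_derivativeP.
split=> [|t t0]; first exact: locally_integrable_on_nonnegD.
by rewrite primitiveD//= f1E// f2E//; ring.
Qed.

Lemma ac_derivativeZ c f g : ac_derivative f g ->
  ac_derivative (fun t => c * f t) (fun t => c * g t).
Proof.
move=> /ac_derivativeP[ig fE]; apply/ac_derivativeP.
split=> [|t t0]; first exact: locally_integrable_on_nonnegZ.
by rewrite primitiveZ//= fE//; ring.
Qed.

Lemma ac_derivative_sqr f g : ac_derivative f g ->
  ac_derivative (fun t => f t ^+ 2) (fun t => 2 * f t * g t).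
Proof.
move=> fg.
apply: (ac_derivative_comp (phi := fun y => y ^+ 2) (dphi := fun y => 2 * y) fg).
  move=> t _; apply: (@filterE _ (nbhs (f t : R))) => y.
  by apply: is_derive_eq; rewrite /GRing.scale/=; ring.
by move=> t _; exact: mulrl_continuous.
Qed.

(** Polarisation: f1 f2 = ((f1 + f2)^2 - (f1 - f2)^2) / 4. *)
Lemma ac_derivativeM f1 f2 g1 g2 : ac_derivative f1 g1 -> ac_derivative f2 g2 ->
  ac_derivative (f1 \* f2) (fun t => g1 t * f2 t + f1 t * g2 t).
Proof.
move=> fg1 fg2.
have fgD := ac_derivative_sqr (ac_derivativeD fg1 fg2).
have fgB := ac_derivative_sqr (ac_derivativeD fg1 (ac_derivativeZ (-1) fg2)).
have := ac_derivativeZ (1 / 4) (ac_derivativeD fgD (ac_derivativeZ (-1) fgB)).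
by apply: eq_ac_derivative => t _ /=; field.
Qed.

End AcAlgebra.

(** * Periodic functions and their means *)

Section Periodic.
Context {R : realType}.
Notation leb := (@lebesgue_measure R).
Variables (T : R) (g : R -> R).
Hypotheses (T_gt0 : 0 < T) (gT : periodic_on_nonneg T g).

Let shift_itv (a b : R) :
  [set x : R | (`[a + T, b + T]%classic : set R) (x + T)] = `[a, b]%classic.
Proof. by apply/seteqP; split => x /=; rewrite !in_itv/= !lerD2r. Qed.

Lemma periodic_locally_integrable :
  leb.-integrable `[0, T] (EFin \o g) -> locally_integrable_on_nonneg g.
Proof.
move=> ig.
have step n : leb.-integrable `[0, n.+1%:R * T] (EFin \o g).
  elim: n => [|n ih]; first by rewrite mul1r.
  (* The interval [T, (n + 2) T] is a translate of [0, (n + 1) T]. *)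
  have := integrable_shift (- T) (measurable_itv _) ih.
  have -> : [set x | (`[0, n.+1%:R * T]%classic : set R) (x - T)] =
      `[T, n.+2%:R * T]%classic.
    have nT : n.+2%:R * T = n.+1%:R * T + T by rewrite -natr1 mulrDl mul1r.
    by apply/seteqP; split => x /=; rewrite !in_itv/= subr_ge0 lerBlDr nT.
  move=> igT; have {igT ih} ig2 : leb.-integrable `[T, n.+2%:R * T] (EFin \o g).
    apply: eq_integrable igT => //= x; rewrite inE/= in_itv/= => /andP[Tx _].
    by rewrite -{2}(subrK T x) gT// subr_ge0.
  have -> : `[0, n.+2%:R * T]%classic =
      `[0, T]%classic `|` `[T, n.+2%:R * T]%classic.
    apply/seteqP; split => x /=; rewrite !in_itv/=.
      by move=> /andP[x0 xn]; have [xT|/ltW xT] := leP x T; [left|right]; apply/andP.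
    move=> [/andP[-> xT]|/andP[Tx ->]]; last by rewrite (le_trans (ltW T_gt0)).
    by rewrite (le_trans xT)// ler_peMl ?(ltW T_gt0)// ler1n.
  exact: integrable_setU.
move=> t t0.
have tT : t <= (Num.truncn (t / T)).+1%:R * T.
  by rewrite -ler_pdivrMr// ltW// truncnS_gt.
apply: integrableS (step (Num.truncn (t / T))) => //= x /=.
by rewrite !in_itv/= => /andP[-> xt]; exact: le_trans tT.
Qed.

Lemma primitive_periodic t : locally_integrable_on_nonneg g -> 0 <= t ->
  primitive g (t + T) = primitive g t + primitive g T.
Proof.
move=> ig t0; have T0 := ltW T_gt0.
have tT : T <= t + T by rewrite lerDr.
rewrite -[LHS](subrK (primitive g T)); congr (_ + _).
have iT : leb.-integrable `[T, t + T] (EFin \o g).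
  apply: integrableS (ig (t + T) _) => //=; last by rewrite addr_ge0.
  by move=> x /=; rewrite !in_itv/= => /andP[Tx ->]; rewrite (le_trans T0).
rewrite primitiveB// Rintegral_itv_obnd_cbnd//; last first.
  by apply: integrableS iT => //=; apply: subset_itvr; rewrite bnd_simp.
rewrite (Rintegral_shift T)//.
have := shift_itv 0 t; rewrite add0r => ->.
by apply: eq_Rintegral => s; rewrite inE/= in_itv/= => /andP[s0 _]; exact: gT.
Qed.

End Periodic.

Section Mean.
Context {R : realType}.
Notation leb := (@lebesgue_measure R).
Implicit Types (f g : R -> R) (T : R).

Lemma mean_primitive T g : mean T g = T^-1 * primitive g T.
Proof. by []. Qed.

Lemma eq_mean T f g : (forall t : R, 0 <= t -> f t = g t) -> mean T f = mean T g.
Proof. by move=> fg; rewrite !mean_primitive (eq_primitive T fg). Qed.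

Lemma mean_ge0 T f : 0 < T -> (forall t : R, 0 <= t -> 0 <= f t) -> 0 <= mean T f.
Proof.
move=> T0 f0; rewrite mulr_ge0 ?invr_ge0 ?(ltW T0)//; apply: Rintegral_ge0 => t /=.
by rewrite in_itv/= => /andP[t0 _]; exact: f0.
Qed.

Lemma mean_gt0 T f : 0 < T -> continuous f -> (forall t : R, 0 <= t -> 0 < f t) ->
  0 < mean T f.
Proof.
move=> T0 cf f0; rewrite mean_primitive mulr_gt0 ?invr_gt0//.
have [|c /itvP cT cmin] := @EVT_min R f 0 T (ltW T0).
  exact: continuous_subspaceT.
apply: (@lt_le_trans _ _ (f c * T)); first by rewrite mulr_gt0 ?f0// cT.
rewrite -primitive_cst ?(ltW T0)//; apply: le_Rintegral => //.
- apply: (locally_integrable_on_nonneg_continuous (g := cst (f c))) (ltW T0).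
  exact: cst_continuous.
- exact: (locally_integrable_on_nonneg_continuous cf (ltW T0)).
Qed.

Lemma meanZD T (a b : R) f g : 0 < T ->
  locally_integrable_on_nonneg f -> locally_integrable_on_nonneg g ->
  mean T (fun t => a * f t + b * g t) = a * mean T f + b * mean T g.
Proof.
move=> T0 fi gi; have T0' := ltW T0.
rewrite !mean_primitive.
rewrite (@primitiveD _ (fun t => a * f t) (fun t => b * g t))//; last 2 first.
- exact: locally_integrable_on_nonnegZ.
- exact: locally_integrable_on_nonnegZ.
by rewrite !primitiveZ//; ring.
Qed.

End Mean.

(** * Dilations of the size variable *)

Section Rescale.
Context {R : realType}.
Notation leb := (@lebesgue_measure R).
Variables (kappa : {measure set (measurableTypeR R) -> \bar R}) (beta gamma : R).
Implicit Types (U : R -> R) (c d x : R).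

Definition rescale c d U x : R := c * U (d * x).

Lemma is_derive_rescale c d U x : derivable U (d * x) 1 ->
  is_derive x 1 (rescale c d U) (c * d * derive1 U (d * x)).
Proof.
move=> dU.
have dUx : is_derive (d * x) 1 U (derive1 U (d * x)).
  by apply: DeriveDef => //; rewrite derive1E.
have ddx : is_derive x 1 ( *%R d) d.
  by apply: is_derive_eq; rewrite /GRing.scale/= ?mulr1.
have dUd : is_derive x 1 (U \o ( *%R d)) (derive1 U (d * x) * d).
  exact: is_derive1_comp.
rewrite (_ : rescale c d U = c \*: (U \o ( *%R d))); last exact/funext.
by apply: is_derive_eq; rewrite /GRing.scale/=; ring.
Qed.

Lemma is_derive_growth_rescale c d a U x : derivable U (d * x) 1 ->
  is_derive x 1 (fun y => a * y * rescale c d U y)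
    (a * c * (U (d * x) + d * x * derive1 U (d * x))).
Proof.
move=> dU; have dr := is_derive_rescale c dU.
rewrite (_ : (fun _ => _) = (( *%R a) \* rescale c d U)); last exact/funext.
by apply: is_derive_eq; rewrite /GRing.scale/= /rescale; ring.
Qed.

Lemma derivable_measurable U : (forall x, 0 < x -> derivable U x 1) ->
  measurable_fun (`]0, +oo[ : set (measurableTypeR R)) U.
Proof.
move=> dU; apply: open_continuous_measurable_fun; first exact: interval_open.
move=> x; rewrite inE/= in_itv/= andbT => x0.
exact/differentiable_continuous/derivable1_diffP/dU.
Qed.

(** The homogeneity of the fragmentation operator appears here: the factor
    y^gamma of the division rate contributes d^(-gamma). *)
Lemma gain_integrand_rescale c d U x z : 0 < d -> 0 < x -> 0 < z ->
  gain_integrand beta gamma (rescale c d U) x z =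
  c * d `^ (- gamma) * gain_integrand beta gamma U (d * x) z.
Proof.
move=> d0 x0 z0; rewrite /gain_integrand /rescale.
have -> : d * x / z = d * (x / z) by rewrite mulrA.
rewrite (@powRM _ d (x / z)) ?(ltW d0)//; last by rewrite divr_ge0// ltW.
rewrite powRN; have dg : d `^ gamma != 0 by rewrite gt_eqF// powR_gt0.
by field; rewrite gt_eqF.
Qed.

Lemma gain_integrable_rescale c d U x : 0 < d -> 0 < x ->
  gain_integrable kappa beta gamma U (d * x) ->
  gain_integrable kappa beta gamma (rescale c d U) x.
Proof.
move=> d0 x0 iU; rewrite /gain_integrable.
have := @integrableZl _ _ _ kappa _ (measurable_itv `]0, 1])
  (c * d `^ (- gamma)) _ iU.
apply: eq_integrable => //= z; rewrite inE/= in_itv/= => /andP[z0 _].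
by rewrite gain_integrand_rescale.
Qed.

Lemma frag_rescale c d U x : 0 < d -> 0 < x ->
  gain_integrable kappa beta gamma U (d * x) ->
  frag kappa beta gamma (rescale c d U) x =
  c * d `^ (- gamma) * frag kappa beta gamma U (d * x).
Proof.
move=> d0 x0 iU; rewrite /frag mulrBr -RintegralZl//.
congr (_ - _).
  apply: eq_Rintegral => z; rewrite inE/= in_itv/= => /andP[z0 _].
  exact: gain_integrand_rescale.
rewrite /rescale powRM ?(ltW d0) ?(ltW x0)// powRN.
have dg : d `^ gamma != 0 by rewrite gt_eqF// powR_gt0.
by field.
Qed.

Lemma ge0_integral_rescale d U : 0 < d ->
  measurable_fun (`]0, +oo[ : set (measurableTypeR R)) U ->
  (forall x, 0 < x -> 0 <= U x) ->
  (\int[leb]_(x in `]0%R, +oo[) (U (d * x))%:E =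
   d^-1%:E * \int[leb]_(x in `]0%R, +oo[) (U x)%:E)%E.
Proof.
move=> d0 mU U0.
have posE : [set x | (`]0, +oo[%classic : set R) (d * x + 0)] = `]0, +oo[%classic.
  by apply/seteqP; split=> x /=; rewrite !in_itv/= addr0 !andbT pmulr_rgt0.
rewrite (@ge0_integral_affine R d 0 d0 _ (fun x => (U x)%:E) (measurable_itv _)).
- rewrite posE muleA -EFinM mulVf ?gt_eqF// mul1e.
  by apply: eq_integral => x _; rewrite addr0.
- exact/measurable_EFinP.
- by move=> x /=; rewrite in_itv/= andbT lee_fin; exact: U0.
Qed.

Lemma mass_rescale c d U : 0 <= c -> 0 < d -> 
  (forall x, 0 < x -> derivable U x 1) -> (forall x, 0 < x -> 0 <= U x) ->
  mass U != 0 -> mass (rescale c d U) = c / d * mass U.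
Proof.
move=> c0 d0 dU U0 mU.
have mUm := derivable_measurable dU.
have U0' z : (`]0, +oo[%classic : set R) z -> (0 <= (U z)%:E)%E.
  by move=> /=; rewrite in_itv/= andbT lee_fin; exact: U0.
rewrite /mass /Rintegral /rescale.
rewrite (@ge0_integral_rescale d (fun x => c * U x))//; last 2 first.
- exact: measurable_funM.
- by move=> x x0; rewrite mulr_ge0// U0.
have -> : (\int[leb]_(x in `]0%R, +oo[) (c * U x)%:E =
    c%:E * \int[leb]_(x in `]0%R, +oo[) (U x)%:E)%E.
  by rewrite -ge0_integralZl//; exact/measurable_EFinP.
rewrite muleA -EFinM fineM//=; first by rewrite (mulrC c).
rewrite ge0_fin_numE ?integral_ge0// ltey; apply: contra_neq mU.
by rewrite /mass /Rintegral => ->.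
Qed.

(** The coefficients a and b are the moments of U of orders 0 and gamma + 1.  An
    exact formula, and not only a bound, is what makes the weighted mass of a
    self-similar solution a continuous function of time. *)
Lemma weighted_mass_rescale U :
  (forall x, 0 < x -> derivable U x 1) -> (forall x, 0 < x -> 0 <= U x) ->
  (weighted_mass gamma U < +oo)%E ->
  exists a b : R, forall c d, 0 <= c -> 0 < d ->
    weighted_mass gamma (rescale c d U) =
      (c / d * (a + d `^ (- (gamma + 1)) * b))%:E.
Proof.
move=> dU U0 wU; have mUm := derivable_measurable dU.
pose P x := x `^ (gamma + 1) * U x.
have mP : measurable_fun (`]0, +oo[ : set (measurableTypeR R)) P.
  apply: measurable_funM => //; apply: measurable_funTS; exact: measurable_powR.
have P0 x : 0 < x -> 0 <= P x by move=> x0; rewrite mulr_ge0 ?powR_ge0 ?U0.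
have pos (Q : R -> R) : (forall x, 0 < x -> 0 <= Q x) ->
    forall z, (`]0, +oo[%classic : set R) z -> (0 <= (Q z)%:E)%E.
  by move=> Q0 z /=; rewrite in_itv/= andbT lee_fin; exact: Q0.
pose I (Q : R -> R) := (\int[leb]_(x in `]0%R, +oo[) (Q x)%:E)%E.
have wE : weighted_mass gamma U = (I U + I P)%E.
  rewrite /I -ge0_integralD//; last 4 first.
  - exact: pos.
  - exact/measurable_EFinP.
  - exact: pos.
  - exact/measurable_EFinP.
  by apply: eq_integral => x _; rewrite /P -EFinD mulrDl mul1r.
have I_ge0 (Q : R -> R) : (forall x, 0 < x -> 0 <= Q x) -> (0 <= I Q)%E.
  by move=> Q0; apply: integral_ge0; exact: pos.
have IUfin : I U \is a fin_num.
  rewrite ge0_fin_numE ?I_ge0//; apply: le_lt_trans wU; rewrite wE leeDl// I_ge0//.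
have IPfin : I P \is a fin_num.
  rewrite ge0_fin_numE ?I_ge0//; apply: le_lt_trans wU; rewrite wE leeDr// I_ge0//.
exists (fine (I U)), (fine (I P)) => c d c0 d0.
have dg : 0 <= d `^ (- (gamma + 1)) by exact: powR_ge0.
(* After the substitution y = d x the integrand is Q(y). *)
pose Q x := c * (U x + d `^ (- (gamma + 1)) * P x).
transitivity (\int[leb]_(x in `]0%R, +oo[) (Q (d * x))%:E)%E.
  apply: eq_integral => x; rewrite inE/= in_itv/= andbT => x0.
  congr EFin; rewrite /rescale /Q /P (powRM _ (ltW d0) (ltW x0)) powRN.
  have dg' : d `^ (gamma + 1) != 0 by rewrite gt_eqF// powR_gt0.
  by field.
have mPd : measurable_fun (`]0, +oo[ : set (measurableTypeR R))
    (fun x => d `^ (- (gamma + 1)) * P x).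
  exact: measurable_funM.
have mQ' : measurable_fun (`]0, +oo[ : set (measurableTypeR R))
    (fun x => U x + d `^ (- (gamma + 1)) * P x).
  exact: measurable_funD.
have mQ : measurable_fun (`]0, +oo[ : set (measurableTypeR R)) Q.
  exact: measurable_funM.
have PP0 x : 0 < x -> 0 <= d `^ (- (gamma + 1)) * P x.
  by move=> x0; rewrite mulr_ge0// P0.
have Q0' x : 0 < x -> 0 <= U x + d `^ (- (gamma + 1)) * P x.
  by move=> x0; rewrite addr_ge0 ?U0// PP0.
have Q0 x : 0 < x -> 0 <= Q x by move=> x0; rewrite mulr_ge0// Q0'.
rewrite ge0_integral_rescale// /Q.
under eq_integral do rewrite EFinM.
rewrite ge0_integralZl//; last 2 first.
- exact/measurable_EFinP.
- exact: pos.
under eq_integral do rewrite EFinD.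
rewrite ge0_integralD//; last 4 first.
- exact: pos.
- exact/measurable_EFinP.
- exact: pos.
- exact/measurable_EFinP.
under [X in (_ * (_ * (_ + X)))%E]eq_integral do rewrite EFinM.
rewrite [X in (_ * (_ * (_ + X)))%E]ge0_integralZl//; last 2 first.
- exact/measurable_EFinP.
- exact: pos.
rewrite -/(I U) -/(I P) -(fineK IUfin) -(fineK IPfin) -!EFinM /=.
by congr EFin; ring.
Qed.

Lemma zero_flux_rescale c d U : 0 < d -> zero_flux U -> zero_flux (rescale c d U).
Proof.
move=> d0 U0; rewrite /zero_flux.
have -> : (fun x => x * rescale c d U x) =
    (fun x => c / d * ((fun y => y * U y) (d * x))).
  by apply/funext => x; rewrite /rescale/=; field; rewrite gt_eqF.
rewrite -[X in _ --> X](mulr0 (c / d)); apply: cvgMr.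
apply: (@cvg_comp _ _ _ ( *%R d) (fun x => x * U x) _ (0^'+)); last exact: U0.
move=> A /nbhs_ballP[e /= e0 eA]; apply/nbhs_ballP.
exists (e / d) => /=; first by rewrite divr_gt0.
move=> x; rewrite /ball/= sub0r normrN => xe x0.
apply: eA; rewrite ?mulr_gt0//.
by rewrite /ball/= sub0r normrN normrM gtr0_norm// mulrC -ltr_pdivlMr.
Qed.

End Rescale.

(** * Perron eigenelements at an arbitrary speed *)

Section PerronScaling.
Context {R : realType}.
Notation leb := (@lebesgue_measure R).
Variables (kappa : {measure set (measurableTypeR R) -> \bar R}).
Variables (tau beta gamma mu Lam : R) (U : R -> R).
Hypothesis perron : perron_eigenelements kappa tau beta gamma mu 1 0 Lam U.

Let dU := perron_derivable perron.

(** Solving the eigenvalue equation for frag U eliminates the nonlocal operator: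
    later verifications only involve U and its derivative. *)
Lemma perron_frag y : 0 < y ->
  frag kappa beta gamma U y = Lam * U y + tau * (U y + y * derive1 U y).
Proof.
move=> y0; have dU1 : derivable U (1 * y) 1 by rewrite mul1r; exact: dU.
have := @is_derive_growth_rescale _ 1 1 tau U y dU1.
rewrite !mul1r mulr1 (_ : (fun _ => _) = (fun z => 1 * tau * z * U z)); last first.
  by apply/funext => z; rewrite /rescale !mul1r.
move=> dg; have := perron_equation perron y0.
rewrite derive1E (@derive_val _ _ _ _ _ _ _ dg) => ->; ring.
Qed.

Lemma derive1_rescale c d x : 0 < d -> 0 < x ->
  derive1 (rescale c d U) x = c * d * derive1 U (d * x).
Proof.
move=> d0 x0; rewrite derive1E.
exact: (@derive_val _ _ _ _ _ _ _ (is_derive_rescale c (dU (mulr_gt0 d0 x0)))).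
Qed.

Lemma derivable_rescale c d x : 0 < d -> 0 < x -> derivable (rescale c d U) x 1.
Proof. by move=> d0 x0; case: (is_derive_rescale c (dU (mulr_gt0 d0 x0))). Qed.

Lemma derive1_growth_rescale a c d x : 0 < d -> 0 < x ->
  derive1 (fun y => a * y * rescale c d U y) x =
  a * c * (U (d * x) + d * x * derive1 U (d * x)).
Proof.
move=> d0 x0; rewrite derive1E.
have dr := is_derive_growth_rescale c a (dU (mulr_gt0 d0 x0)).
exact: (@derive_val _ _ _ _ _ _ _ dr).
Qed.

Lemma perron_frag_rescale c d x : 0 < d -> 0 < x ->
  frag kappa beta gamma (rescale c d U) x =
  c * d `^ (- gamma) *
    (Lam * U (d * x) + tau * (U (d * x) + d * x * derive1 U (d * x))).
Proof.
move=> d0 x0; rewrite frag_rescale ?perron_frag ?mulr_gt0//.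
exact/(perron_gain perron)/mulr_gt0.
Qed.

Lemma rescale_ge0 c d x : 0 <= c -> 0 < d -> 0 < x -> 0 <= rescale c d U x.
Proof. by move=> c0 d0 x0; rewrite mulr_ge0// (perron_ge0 perron)// mulr_gt0. Qed.

Lemma perron_continuous x : 0 < x -> {for x, continuous U}.
Proof. by move=> x0; exact/differentiable_continuous/derivable1_diffP/dU. Qed.

Lemma perron_derive_continuous x : 0 < x -> {for x, continuous (derive1 U)}.
Proof. by move=> x0; apply: (perron_C1 perron); rewrite in_itv/= andbT. Qed.

Lemma perron_mass_rescale c d : 0 <= c -> 0 < d -> mass (rescale c d U) = c / d.
Proof.
move=> c0 d0; rewrite mass_rescale ?(perron_mass perron) ?mulr1 ?oner_eq0//.
exact: (perron_ge0 perron).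
Qed.

(** The speed is v = d^(-gamma), that is d = v^(-k).  The amplitude is d as well,
    so that the total mass stays equal to 1. *)
Lemma perron_rescale r d : 0 < d ->
  perron_eigenelements kappa tau beta gamma mu (d `^ (- gamma)) r
    (d `^ (- gamma) * Lam - r * mu) (rescale d d U).
Proof.
move=> d0; have d0' := ltW d0.
split.
- by move=> x; exact: derivable_rescale.
- move=> x; rewrite in_itv/= andbT => x0.
  rewrite /continuous_at derive1_rescale//.
  suff cvg_dU : d * d * derive1 U (d * y) @[y --> x] --> d * d * derive1 U (d * x).
    apply: cvg_trans cvg_dU; apply: near_eq_cvg; have := lt_nbhsr x0.
    by apply: filterS => y y0; rewrite derive1_rescale.
  apply: cvgMr.
  apply: (@continuous_comp _ _ _ ( *%R d) (derive1 U)).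
    exact: mulrl_continuous.
  exact/perron_derive_continuous/mulr_gt0.
- by move=> x; exact: rescale_ge0.
- move=> x x0; apply: gain_integrable_rescale => //.
  exact/(perron_gain perron)/mulr_gt0.
- have [a [b ->//]] :=
    weighted_mass_rescale dU (perron_ge0 perron) (perron_weighted perron).
  exact: ltry.
- move=> x x0.
  by rewrite perron_frag_rescale// derive1_growth_rescale// /rescale; ring.
- exact/zero_flux_rescale/(perron_boundary perron).
- by rewrite perron_mass_rescale// divff// gt_eqF.
Qed.

End PerronScaling.

(** * Self-similar solutions driven by the logistic equation *)

Section Logistic.
Context {R : realType}.
Implicit Types (V W m : R -> R).

(** Divided by W, the logistic equation gives the growth rate of the dilation
    factor W^(-k). *)
Lemma logistic_ln_ac (tau k : R) V W : k != 0 ->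
  (forall t, 0 <= t -> 0 < W t) ->
  ac_derivative W (fun t => tau * W t / k * (V t - W t)) ->
  ac_derivative (fun t => - k * ln (W t)) (fun t => tau * (W t - V t)).
Proof.
move=> k0 W_gt0 acW.
have := ac_derivative_comp (phi := @ln R) (dphi := fun y => y^-1) acW _ _.
move=> /(_ _ _)/(@ac_derivativeZ _ (- k)) lnW.
apply: eq_ac_derivative (lnW _ _) => //.
- move=> t t0 /=; have W0 := W_gt0 _ t0.
  by field; rewrite k0 gt_eqF.
- move=> t t0; have := lt_nbhsr (W_gt0 _ t0).
  by apply: filterS => y y0; exact: is_derive1_ln.
- by move=> t t0; apply: inv_continuous; rewrite gt_eqF ?W_gt0.
Qed.

Lemma continuous_expR_powR m q : continuous m ->
  continuous (fun t => expR (m t) `^ q).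
Proof.
move=> cm.
rewrite (_ : (fun _ => _) = (fun t => expR (q * m t))); last first.
  by apply/funext => t; rewrite /powR gt_eqF ?expR_gt0// expRK.
move=> t; apply: (@continuous_comp _ _ _ (fun t => q * m t) expR).
  by apply: cvgMr; exact: cm.
exact: continuous_expR.
Qed.

End Logistic.

Section SelfSimilarSolution.
Context {R : realType}.
Notation leb := (@lebesgue_measure R).
Variables (kappa : {measure set (measurableTypeR R) -> \bar R}).
Variables (tau beta gamma mu Lam : R) (U : R -> R).
Hypothesis perron : perron_eigenelements kappa tau beta gamma mu 1 0 Lam U.
Variables (V Rc W m a : R -> R) (C : R).
Hypotheses (C_ge0 : 0 <= C) (m_cont : continuous m) (a_cont : continuous a).
Hypotheses (WE : forall t, 0 <= t -> expR (m t) `^ (- gamma) = W t)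
  (m_ac : ac_derivative m (fun t => tau * (W t - V t)))
  (a_ac : ac_derivative a (fun t => Lam * W t - mu * Rc t)).

Let amp t := C * expR (a t + m t).
Let amp_cont : continuous amp.
Proof.
move=> t; apply: cvgMr.
apply: (@continuous_comp _ _ _ (a \+ m) expR); last exact: continuous_expR.
by apply: continuousD; [exact: a_cont|exact: m_cont].
Qed.

Let dil_cont : continuous (fun t => expR (m t)).
Proof.
move=> t; apply: continuous_comp; first exact: m_cont.
exact: continuous_expR.
Qed.

Lemma continuous_rescale_pair (al de h : R -> R) (p : R * R) :
  continuous al -> continuous de -> {for de p.1 * p.2, continuous h} ->
  {for p, continuous (fun q : R * R => rescale (al q.1) (de q.1) h q.2)}.
Proof.
move=> cal cde ch; rewrite /rescale; apply: continuousM.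
  by apply: continuous_comp; [exact: cvg_fst|exact: cal].
apply: (@continuous_comp _ _ _ (fun q : R * R => de q.1 * q.2) h) => //.
apply: continuousM; last exact: cvg_snd.
by apply: continuous_comp; [exact: cvg_fst|exact: cde].
Qed.

Lemma amplitude_profile_ac x : 0 < x ->
  ac_derivative (fun t => rescale (amp t) (expR (m t)) U x)
    (fun t => amp t *
      ((Lam * W t - mu * Rc t + tau * (W t - V t)) * U (expR (m t) * x) +
       tau * (W t - V t) * (expR (m t) * x) * derive1 U (expR (m t) * x))).
Proof.
move=> x0.
have acE : ac_derivative (fun t => expR (a t + m t))
    (fun t => expR (a t + m t) * (Lam * W t - mu * Rc t + tau * (W t - V t))).
  apply: (ac_derivative_comp (phi := expR) (dphi := expR)
    (ac_derivativeD a_ac m_ac)).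
    by move=> t _; apply: (@filterE _ (nbhs (_ : R))) => y; exact: is_derive_expR.
  by move=> t _; exact: continuous_expR.
have acU : ac_derivative (fun t => U (expR (m t) * x))
    (fun t => derive1 U (expR (m t) * x) * (expR (m t) * x) * (tau * (W t - V t))).
  apply: (ac_derivative_comp (phi := fun y => U (expR y * x))
      (dphi := fun y => derive1 U (expR y * x) * (expR y * x)) m_ac).
    move=> t _; apply: (@filterE _ (nbhs (_ : R))) => y.
    have yx : 0 < expR y * x by rewrite mulr_gt0 ?expR_gt0.
    have dUy : is_derive (expR y * x) 1 U (derive1 U (expR y * x)).
      by apply: DeriveDef; [exact: (perron_derivable perron)|rewrite derive1E].
    have dE : is_derive y 1 (fun y => expR y * x) (expR y * x).
      by apply: is_derive_eq; rewrite /GRing.scale/=; ring.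
    exact: is_derive1_comp.
  move=> t _.
  have yx : 0 < expR (m t) * x by rewrite mulr_gt0 ?expR_gt0.
  have cE : {for m t, continuous (fun y => expR y * x)}.
    by apply: cvgMl; exact: continuous_expR.
  apply: continuousM (cE).
  apply: (@continuous_comp _ _ _ (fun y => expR y * x) (derive1 U)) => //.
  exact: (perron_derive_continuous perron).
have := ac_derivativeZ C (ac_derivativeM acE acU).
by apply: eq_ac_derivative => t _; rewrite /= /rescale /amp; ring.
Qed.

(** Here m is the logarithm of the dilation factor and a is the primitive of
    Lam(W, R).  At each time the profile is the Perron eigenvector at speed W(t),
    and in the resulting identity the terms in U and in its derivative cancel
    separately. *)
Lemma self_similar_solution :
  nonneg_solution kappa tau beta gamma mu V Rc
    (fun t => rescale (amp t) (expR (m t)) U).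
Proof.
have e0 t : 0 < expR (m t) := expR_gt0 _.
have amp0 t : 0 <= amp t by rewrite mulr_ge0// expR_ge0.
have dU := perron_derivable perron.
split.
- apply: continuous_in_subspaceT => p; rewrite inE/= => -[_ p2].
  apply: (@continuous_rescale_pair amp (fun t => expR (m t)) U p) => //.
  by apply: (perron_continuous perron); rewrite mulr_gt0.
- by move=> t x _ x0; exact: derivable_rescale perron _ _ _ _ _.
- apply: (@subspace_eq_continuous _ _ _
    (fun p : R * R =>
      rescale (amp p.1 * expR (m p.1)) (expR (m p.1)) (derive1 U) p.2)).
    move=> p; rewrite inE/= => -[_ p2].
    by apply: esym; exact: (derive1_rescale perron).
  apply: continuous_in_subspaceT => p; rewrite inE/= => -[_ p2].
  apply: (@continuous_rescale_pair (fun t => amp t * expR (m t))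
    (fun t => expR (m t)) (derive1 U) p) => //.
    by move=> t; apply: continuousM; [exact: amp_cont|exact: dil_cont].
  by apply: (perron_derive_continuous perron); rewrite mulr_gt0.
- by move=> t x _ x0; exact: (rescale_ge0 perron).
- move=> t x _ x0; apply: gain_integrable_rescale => //.
  by apply: (perron_gain perron); rewrite mulr_gt0.
- move=> t t0.
  have [b1 [b2 wE]] :=
    weighted_mass_rescale dU (perron_ge0 perron) (perron_weighted perron).
  pose w s := amp s / expR (m s) * (b1 + expR (m s) `^ (- (gamma + 1)) * b2).
  rewrite (eq_integral (fun s : measurableTypeR R => (w s)%:E)); last first.
    by move=> s _; rewrite wE.
  apply: integrable_lty => //.
  apply: (locally_integrable_on_nonneg_continuous (g := w)) => //.
  have pow_cont := continuous_expR_powR (q := - (gamma + 1)) m_cont.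
  move=> s; apply: cvgM.
    apply: cvgM; first exact: amp_cont.
    by apply: cvgV; [rewrite gt_eqF|exact: dil_cont].
  apply: cvgD; first exact: cvg_cst.
  apply: cvgMl; exact: pow_cont.
- move=> x x0; apply: eq_ac_derivative (amplitude_profile_ac x0) => // t t0.
  rewrite (derive1_growth_rescale perron)// (perron_frag_rescale perron)//.
  by rewrite WE// /rescale; ring.
- by move=> t t0; apply: zero_flux_rescale => //; exact: (perron_boundary perron).
Qed.

End SelfSimilarSolution.

(** * Floquet eigenelements *)

Unset Implicit Arguments.

Theorem proposition6p1 (R : realType)
  (kappa : {measure set (measurableTypeR R) -> \bar R})
  (tau beta gamma mu k T : R)
  (Lam : R -> R -> R) (U : R -> R -> R)
  (V Rc W : R -> R) (LamF : R) (UF : R -> R -> R)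
  (kappa_supp : kappa (~` `[0, 1]) = 0%E)
  (kappa_moment : (\int[kappa]_(z in `[0%R, 1%R]) z%:E = 1)%E)
  (tau_gt0 : 0 < tau) (beta_gt0 : 0 < beta) (gamma_gt0 : 0 < gamma)
  (mu_ge0 : 0 <= mu) (kE : k = 1 / gamma) (T_gt0 : 0 < T)
  (* Perron eigenelements; the eigenvector does not depend on r *)
  (perron : forall v r, 0 < v -> 0 <= r ->
    unique_perron_eigenelements kappa tau beta gamma mu v r (Lam v r) (U v))
  (* T-periodic controls *)
  (V_gt0 : forall t, 0 <= t -> 0 < V t)
  (V_periodic : periodic_on_nonneg T V)
  (V_integrable : lebesgue_measure.-integrable `[0, T] (EFin \o V))
  (Rc_ge0 : forall t, 0 <= t -> 0 <= Rc t)
  (Rc_periodic : periodic_on_nonneg T Rc)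
  (Rc_integrable : lebesgue_measure.-integrable `[0, T] (EFin \o Rc))
  (* the positive T-periodic solution of W' = (tau W / k) (V - W) *)
  (W_gt0 : forall t, 0 <= t -> 0 < W t)
  (W_periodic : periodic_on_nonneg T W)
  (W_equation : ac_derivative W (fun t => tau * W t / k * (V t - W t)))
  (floquet :
    unique_floquet_eigenelements kappa tau beta gamma mu T V Rc LamF UF) :
  (exists C : R, 0 < C /\
    forall t x, 0 <= t -> 0 < x ->
      UF t x = C * U (W t) x *
        expR (\int[lebesgue_measure]_(s in `[0, t])
                (Lam (W s) (Rc s) - LamF))) /\
  LamF = Lam (mean T V) (mean T Rc) /\
  Lam (mean T V) (mean T Rc) = mean T (fun t => Lam (V t) (Rc t)).
Proof.
have g_neq0 : gamma != 0 by rewrite gt_eqF.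
have k0 : 0 < k by rewrite kE divr_gt0.
set U1 := U 1; set L1 := Lam 1 0.
have P1 : perron_eigenelements kappa tau beta gamma mu 1 0 L1 U1.
  by have [] := perron 1 0 ltr01 (lexx 0).
have powk (v : R) : 0 < v -> (v `^ (- k)) `^ (- gamma) = v.
  by move=> v0; rewrite -powRrM mulrNN kE mul1r mulVf// powRr1// ltW.
have perronE v r : 0 < v -> 0 <= r -> Lam v r = v * L1 - r * mu /\
    forall x, 0 < x -> U v x = rescale (v `^ (- k)) (v `^ (- k)) U1 x.
  move=> v0 r0; have [_ uniq] := perron v r v0 r0.
  have := perron_rescale P1 r (powR_gt0 (- k) v0).
  rewrite powk// => /uniq[<- UE]; split=> // x x0.
  by rewrite UE.
have lnW_ac : ac_derivative (fun t => - k * ln (W t)) (fun t => tau * (W t - V t)).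
  by apply: logistic_ln_ac W_equation; rewrite // gt_eqF.
have [WV_int mE] := (ac_derivativeP _ _).1 lnW_ac.
(* m agrees with -k ln W at nonnegative times, and is continuous everywhere. *)
pose m t := - k * ln (W 0) + primitive (fun t => tau * (W t - V t)) t.
have mWE t : 0 <= t -> m t = - k * ln (W t) by move=> /mE ->.
have m_ac : ac_derivative m (fun t => tau * (W t - V t)).
  exact: ac_derivative_primitive.
have m_cont : continuous m.
  by move=> t; apply: cvgD; [exact: cvg_cst|exact: primitive_continuous].
have em t : 0 <= t -> expR (m t) = W t `^ (- k).
  by move=> t0; rewrite mWE// /powR gt_eqF// W_gt0.
have WE t : 0 <= t -> expR (m t) `^ (- gamma) = W t.
  by move=> t0; rewrite em// powk// W_gt0.
have em_cont := continuous_expR_powR (q := - gamma) m_cont.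
have W_int : locally_integrable_on_nonneg W.
  exact: eq_locally_integrable WE (locally_integrable_on_nonneg_continuous em_cont).
have V_int : locally_integrable_on_nonneg V.
  exact: periodic_locally_integrable V_integrable.
have Rc_int : locally_integrable_on_nonneg Rc.
  exact: periodic_locally_integrable Rc_integrable.
have m_per t : 0 <= t -> m (t + T) = m t.
  by move=> t0; rewrite !mWE ?W_periodic// addr_ge0// ltW.
(* As m is periodic, its derivative tau (W - V) has zero mean. *)
have mean_WV : mean T W = mean T V.
  have := m_per 0 (lexx 0); rewrite add0r /m primitive0 => /addrI pT.
  have : mean T (fun t => tau * W t + (- tau) * V t) = 0.
    rewrite (@eq_mean _ T _ (fun t => tau * (W t - V t))); last by move=> t _; ring.
    by rewrite mean_primitive pT mulr0.
  rewrite meanZD// mulNr -mulrBr => /eqP.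
  by rewrite mulf_eq0 gt_eqF//= subr_eq0 => /eqP.
have meanV_gt0 : 0 < mean T V.
  rewrite -mean_WV -(eq_mean T WE); apply: mean_gt0 => // t t0.
  by rewrite WE// W_gt0.
have meanRc_ge0 : 0 <= mean T Rc by exact: mean_ge0.
have [LamE _] := perronE _ _ meanV_gt0 meanRc_ge0.
pose ga t := L1 * W t - mu * Rc t.
have gaE : ga = (fun t => L1 * W t + (- mu) * Rc t).
  by apply/funext => t; rewrite /ga; ring.
have ga_int : locally_integrable_on_nonneg ga.
  rewrite gaE.
  apply: (@locally_integrable_on_nonnegD _ (fun t => L1 * W t) (fun t => - mu * Rc t));
  exact: locally_integrable_on_nonnegZ.
have ga_per : periodic_on_nonneg T ga.
  by move=> t t0; rewrite /ga W_periodic// Rc_periodic.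
pose L := mean T ga.
have LE : L = Lam (mean T V) (mean T Rc).
  by rewrite LamE /L gaE meanZD// mean_WV; ring.
have a_ac : ac_derivative (primitive ga) ga.
  have := ac_derivative_primitive 0 ga_int.
  by apply: eq_ac_derivative => // t _; rewrite add0r.
have a_cont : continuous (primitive ga) by exact: primitive_continuous.
(* The mass of the profile with amplitude exp (p + m) is exp p, hence the
   normalisation by the mean N of exp p. *)
pose p t := primitive ga t - L * t.
have p_cont : continuous p.
  by move=> t; apply: cvgB; [exact: a_cont|exact: mulrl_continuous].
pose N := mean T (fun t => expR (p t)).
have N0 : 0 < N.
  apply: mean_gt0 => // t; last by rewrite expR_gt0.
  by apply: continuous_comp; [exact: p_cont|exact: continuous_expR].
pose C := N^-1.
have C0 : 0 < C by rewrite invr_gt0.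
pose UF' t := rescale (C * expR (p t + m t)) (expR (m t)) U1.
have FE : floquet_eigenelements kappa tau beta gamma mu T V Rc L UF'.
  split.
  - have := @self_similar_solution _ kappa tau beta gamma mu L1 U1 P1 V Rc W m
      (primitive ga) C (ltW C0) m_cont a_cont WE m_ac a_ac.
    congr nonneg_solution; apply/funext => t; apply/funext => x.
    rewrite /UF' /rescale.
    have -> : primitive ga t + m t = (p t + m t) + L * t by rewrite /p; ring.
    by rewrite [expR (_ + L * t)]expRD; ring.
  - move=> x x0 t t0; rewrite /UF' m_per// /p primitive_periodic//.
    have -> // : primitive ga t + primitive ga T - L * (t + T) =
        primitive ga t - L * t.
    by rewrite /L mean_primitive; field; rewrite gt_eqF.
  - rewrite (@eq_mean _ T _ (fun t => C * expR (p t))); last first.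
      move=> t _; rewrite (perron_mass_rescale P1) ?expR_gt0//; last first.
        by rewrite mulr_ge0 ?(ltW C0)// expR_ge0.
      by rewrite expRD mulrA mulfK// gt_eqF// expR_gt0.
    rewrite mean_primitive primitiveZ ?(ltW T_gt0)//.
      by rewrite mulrCA -mean_primitive mulVf// gt_eqF.
    apply: locally_integrable_on_nonneg_continuous => t.
    by apply: continuous_comp; [exact: p_cont|exact: continuous_expR].
have [_ /(_ _ _ FE)[LF UFE]] := floquet.
split; last first.
  rewrite -LF LE; split=> //; rewrite LamE.
  rewrite [RHS](@eq_mean _ T _ (fun t => L1 * V t + (- mu) * Rc t)).
    by rewrite meanZD//; ring.
  by move=> t t0; rewrite (perronE _ _ (V_gt0 _ t0) (Rc_ge0 _ t0)).1; ring.
exists C; split=> // t x t0 x0; rewrite -UFE//.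
have W0 := W_gt0 _ t0.
have [_ ->//] := perronE (W t) 0 W0 (lexx 0).
have -> : \int[lebesgue_measure]_(s in `[0, t]) (Lam (W s) (Rc s) - LamF) = p t.
  transitivity (primitive (fun s => ga s + (cst (- L)) s) t).
    apply: eq_primitive => s s0.
    by rewrite (perronE _ _ (W_gt0 _ s0) (Rc_ge0 _ s0)).1 -LF /ga/=; ring.
  rewrite (@primitiveD _ ga (cst (- L)))// ?primitive_cst// ?/p ?mulNr//.
  by apply: locally_integrable_on_nonneg_continuous; exact: cst_continuous.
by rewrite /UF' /rescale em// expRD em//; ring.
Qed.
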